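(* Let $k\ge 0$, let $\mathcal X\subset\mathbb R^n$ be open, and let $\Phi\in\Xi^k(\mathcal X,\mathbb R)$ be an MLP with weight matrices $W=(W_1,\widetilde W_1,\ldots,W_L,\widetilde W_L)$, at least one of which does not have full rank, and biases $b=(b_1,\tilde b_1,\ldots,b_L,\tilde b_L)$. (a) If $\operatorname{rank}(W_1)>0$, $\operatorname{rank}(\widetilde W_L)>0$ and $\operatorname{rank}(W_{l+1}\widetilde W_l)>0$ for all $l\in\{1,\ldots,L-1\}$, then there exist $\bar n\le n$, a full rank matrix $A\in\mathbb R^{\bar n\times n}$, and an MLP $\overline\Phi\in\Xi^k(\mathcal Y,\mathbb R)$, $\mathcal Y\subset\mathbb R^{\bar n}$, all of whose weight matrices have full rank, such that $\overline\Phi$ has a smaller architecture than $\Phi$ and is equivalent to $\Phi$ up to the linear change of coordinates $A$, i.e. $\Phi(x)=\overline\Phi(Ax)$ for all $x\in\mathcal X$. If $\bar n=n$, then $A$ is the identity matrix and $\mathcal Y=\mathcal X$; if $\bar n<n$, then $\mathcal Y=\{y\in\mathbb R^{\bar n}: y=Ax,\ x\in\mathcal X\}$. (b) If $\operatorname{rank}(W_1)=0$ or $\operatorname{rank}(\widetilde W_L)=0$ or $\operatorname{rank}(W_{l+1}\widetilde W_l)=0$ for some $l\in\{1,\ldots,L-1\}$, then there is a scalar $c_{W,b}$, independent of $x$ and depending only on $W$ and $b$, such that $\Phi(x)=c_{W,b}$ for all $x\in\mathcal X$. Moreover $\Phi$ is equivalent to the MLP $\overline\Phi\in\Xi^k(\mathcal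 X,\mathbb R)$ defined by $\overline L=1$, $\overline W_1=0\in\mathbb R^{1\times n}$, $\overline b_1=0\in\mathbb R$, $\overline{\widetilde W}_1=0\in\mathbb R$ and $\overline{\tilde b}_1=c_{W,b}\in\mathbb R$, which has a smaller architecture than $\Phi$ whenever the architecture (numbers of layers and widths) of $\overline\Phi$ differs from that of $\Phi$.
   Context: MLP setting. An MLP with $L\ge1$ on an open set $\mathcal X\subset\mathbb R^n$ is given by $h_0=x\in\mathcal X$ and, for $l=1,\ldots,L$, $h_l=\widetilde W_l\,\sigma_l(a_l)+\tilde b_l$ with $a_l=W_lh_{l-1}+b_l$, where $W_l\in\mathbb R^{m_l\times n_{l-1}}$, $\widetilde W_l\in\mathbb R^{n_l\times m_l}$, $b_l\in\mathbb R^{m_l}$, $\tilde b_l\in\mathbb R^{n_l}$, all widths are $\ge1$, $n_0=n$, $n_L=1$, and $\sigma_l:\mathbb R^{m_l}\to\mathbb R^{m_l}$ is applied component-wise with components $[\sigma_l]_i:\mathbb R\to\mathbb R$. The network map is $\Phi:\mathcal X\to\mathbb R$, $\Phi(x)=h_L$. For $k\ge0$, $\Xi^k(\mathcal X,\mathbb R)$ is the set of all such MLPs whose activation components $[\sigma_l]_i$ are strictly monotone and of class $C^k$ (strict monotonicity of a differentiable component means: its derivative is everywhere $>0$ or everywhere $<0$). Widths are jointly enumerated by $d_{2l}=n_l$ ($0\le l\le L$) and $d_{2l-1}=m_l$ ($1\le l\le L$). A $p\times q$ matrix has full rank if its rank is $\min\{p,q\}$. Two MLPs on the same $\mathcal X$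 are equivalent if they define the same function on $\mathcal X$. An MLP $\overline\Phi$ with widths $\overline d_j$ ($0\le j\le 2\overline L$, $\overline L\le L$; set $\overline d_j=0$ for $2\overline L<j\le 2L$) has a smaller architecture than $\Phi$ with widths $d_j$ ($0\le j\le 2L$) if $\overline d_j\le d_j$ for all $j\in\{0,\ldots,2L\}$ and the total number of nodes is strictly smaller, $\sum_{j=0}^{2L}\overline d_j<\sum_{j=0}^{2L}d_j$. *)

(* Defs.v *)
From mathcomp Require Import all_boot all_order all_algebra.
From mathcomp Require Import all_classical all_reals all_analysis.

Set Implicit Arguments.
Unset Strict Implicit.
Unset Printing Implicit Defensive.

Import Order.TTheory GRing.Theory Num.Theory.
Import numFieldNormedType.Exports.

Local Open Scope classical_set_scope.
Local Open Scope ring_scope.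

(* Layers are numbered 1, ..., L as on paper, and families indexed by a layer
   are functions on nat: their values outside of the range 1, ..., L are junk
   that no definition below looks at. *)

(* Makes n_0 convertible to n, so that the input needs no cast. *)
Definition with_input (n : nat) (w : nat -> nat) (l : nat) : nat :=
  if l is _.+1 then w l else n.

Record arch (n : nat) := Arch {
  depth : nat;
  outw_pos : nat -> nat;
  hidw : nat -> nat;
  depth_gt0 : (0 < depth)%N;
  outw_gt0 : forall l, (l <= depth)%N -> (0 < with_input n outw_pos l)%N;
  hidw_gt0 : forall l, (1 <= l <= depth)%N -> (0 < hidw l)%N;
  outw_depth : with_input n outw_pos depth = 1%N
}.

(* outw a l is n_l and hidw a l is m_l. *)
Definition outw n (a : arch n) (l : nat) : nat := with_input n (outw_pos a) l.

(* The joint enumeration d_{2l} = n_l, d_{2l-1} = m_l, extended by 0. *)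
Definition width n (a : arch n) (j : nat) : nat :=
  if (j <= (depth a).*2)%N then
    if odd j then hidw a (j./2).+1 else outw a j./2
  else 0%N.

Definition same_arch n n' (a : arch n) (a' : arch n') : Prop :=
  depth a = depth a' /\ forall j, width a j = width a' j.

Definition smaller_arch n' n (a' : arch n') (a : arch n) : Prop :=
  [/\ (depth a' <= depth a)%N,
      forall j, (j <= (depth a).*2)%N -> (width a' j <= width a j)%N
    & (\sum_(0 <= j < (depth a).*2.+1) width a' j
       < \sum_(0 <= j < (depth a).*2.+1) width a j)%N].

(* W l, b l, Wt l, bt l stand for W_l, b_l, \tilde W_l, \tilde b_l. *)
Record params (R : realType) n (a : arch n) := Params {
  W : forall l, 'M[R]_(hidw a l, outw a l.-1);
  b : forall l, 'cV[R]_(hidw a l);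
  Wt : forall l, 'M[R]_(outw a l, hidw a l);
  bt : forall l, 'cV[R]_(outw a l)
}.

Definition activations (R : realType) n (a : arch n) : Type :=
  forall l, 'I_(hidw a l) -> R -> R.

Record mlp (R : realType) n := MLP {
  arch_of : arch n;
  act : activations R arch_of;
  par : params R arch_of
}.

Arguments act {R n} m l i _ : rename.

Section Network.
Variables (R : realType) (n : nat) (Phi : mlp R n).
Let a := arch_of Phi.
Let p := par Phi.

Definition apply_act (l : nat) (v : 'cV[R]_(hidw a l)) : 'cV[R]_(hidw a l) :=
  \col_i act Phi l i (v i 0).

Fixpoint layer (x : 'cV[R]_n) (l : nat) : 'cV[R]_(outw a l) :=
  match l with
  | 0 => x
  | l'.+1 =>
      Wt p l'.+1 *m apply_act (W p l'.+1 *m layer x l' + b p l'.+1)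
      + bt p l'.+1
  end.

Definition network (x : 'cV[R]_n) : R :=
  (castmx (outw_depth a, erefl) (layer x (depth a))) 0 0.

End Network.

Definition Ck (R : realType) (k : nat) (f : R -> R) : Prop :=
  (forall j, (j < k)%N -> forall x, derivable (derive1n j f) x 1) /\
  continuous (derive1n k f).

(* A differentiable function such as x ^ 3, with a critical point, is not
   strictly monotone in this sense. *)
Definition strictly_monotone (R : realType) (f : R -> R) : Prop :=
  let differentiable_everywhere := forall x, derivable f x 1 in
  (differentiable_everywhere ->
     (forall x, 0 < derive1 f x) \/ (forall x, derive1 f x < 0)) /\
  (~ differentiable_everywhere ->
     {homo f : x y / x < y} \/ {homo f : x y /~ x < y}).

Definition Xi (R : realType) (k n : nat) (X : set 'cV[R]_n) (Phi : mlp R n) :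
    Prop :=
  open X /\
  forall l, (1 <= l <= depth (arch_of Phi))%N ->
  forall i : 'I_(hidw (arch_of Phi) l),
    Ck k (act Phi l i) /\ strictly_monotone (act Phi l i).

Definition equivalent (R : realType) n (X : set 'cV[R]_n)
    (Phi Psi : mlp R n) : Prop :=
  forall x, X x -> network Phi x = network Psi x.

Definition full_rank (R : realType) p q (M : 'M[R]_(p, q)) : bool :=
  \rank M == minn p q.

Definition all_full_rank (R : realType) n (a : arch n) (p : params R a) :
    Prop :=
  forall l, (1 <= l <= depth a)%N -> full_rank (W p l) /\ full_rank (Wt p l).

Fact const_arch_outw_gt0 n (n_gt0 : (0 < n)%N) (l : nat) :
  (l <= 1)%N -> (0 < with_input n (fun=> 1%N) l)%N.
Proof. by case: l. Qed.

Definition const_arch n (n_gt0 : (0 < n)%N) : arch n :=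
  @Arch n 1 (fun=> 1%N) (fun=> 1%N) (ltn0Sn 0) (const_arch_outw_gt0 n_gt0)
    (fun _ _ => ltn0Sn 0) erefl.

Definition const_params (R : realType) n (n_gt0 : (0 < n)%N) (c : R) :
    params R (const_arch n_gt0) :=
  @Params R n (const_arch n_gt0)
    (fun=> 0) (fun=> 0) (fun=> 0) (fun=> const_mx c).

Definition const_mlp (R : realType) n (n_gt0 : (0 < n)%N) (tau : R -> R)
    (c : R) : mlp R n :=
  @MLP R n (const_arch n_gt0) (fun _ _ => tau) (const_params n_gt0 c).

(* Main.v *)
(* Between two consecutive hidden layers the network is affine, with linear
   part W_{l+1} Wt_l. If r is the rank of this product, a rank factorization
   replaces W_{l+1} and Wt_l by two full rank matrices meeting in width r, and
   the bias bt_l is absorbed into b_{l+1}. Doing this for all l < L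
   keeps every pre-activation. Moreover r <= n_l, strictly if W_{l+1} or Wt_l
   is not of full rank. Likewise a rank factorization of W_1 yields the change
   of coordinates A. If one of the products has rank 0, then some
   pre-activation (or the output) does not depend on x, so the network is
   constant and its value at 0 can serve as c. *)

Require Import Defs.
From mathcomp Require Import all_boot all_order all_algebra.
From mathcomp Require Import all_classical all_reals all_analysis.

Set Implicit Arguments.
Unset Strict Implicit.
Unset Printing Implicit Defensive.

Import Order.TTheory GRing.Theory Num.Theory.
Import numFieldNormedType.Exports.
Local Open Scope classical_set_scope.
Local Open Scope ring_scope.

(** * Strict comparison of architectures *)

Lemma ltn_sum_nat N (f g : nat -> nat) :
  (forall j, (j < N)%N -> (f j <= g j)%N) ->
  (exists2 j, (j < N)%N & (f j < g j)%N) ->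
  (\sum_(0 <= j < N) f j < \sum_(0 <= j < N) g j)%N.
Proof.
move=> fg [j jN fgj]; rewrite !big_mkord.
rewrite (bigD1 (Ordinal jN)) // [ltnRHS](bigD1 (Ordinal jN)) //=.
by rewrite -addSn leq_add // leq_sum // => i _; apply: fg.
Qed.

Lemma width_gt0 n (a : arch n) j :
  (j <= (depth a).*2)%N -> (0 < width a j)%N.
Proof.
move=> jL; rewrite /width jL; case: ifPn => jodd; last first.
  by apply: outw_gt0; rewrite -leq_double; apply: leq_trans jL;
     rewrite -[leqRHS](odd_double_half j) leq_addl.
apply: hidw_gt0; rewrite /= -ltn_double; apply: leq_trans jL.
by rewrite -[leqRHS](odd_double_half j) jodd.
Qed.

(** The input widths agree, and every other nonzero width of the constant network is 1, hence at
    most the positive width of [a]. If no inequality were strict, the width at index [(depth a).*2]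
    would be positive in both, forcing depth 1 and equal architectures. *)
Lemma smaller_const_arch n (n_gt0 : (0 < n)%N) (a : arch n) :
  ~ same_arch (const_arch n_gt0) a -> smaller_arch (const_arch n_gt0) a.
Proof.
move=> ndiff; set c := const_arch n_gt0.
have le_width j : (j <= (depth a).*2)%N -> (width c j <= width a j)%N.
  move=> ja; case: j ja => [|j] ja; first by rewrite /width.
  apply: leq_trans (width_gt0 ja).
  by case: j ja => [|[|j]].
split=> //; first exact: depth_gt0.
apply: ltn_sum_nat => //; apply: contrapT => noj; apply: ndiff.
have eq_width j : (j <= (depth a).*2)%N -> width c j = width a j.
  move=> ja; apply/eqP; rewrite eqn_leq le_width //= leqNgt.
  by apply/negP => lt; apply: noj; exists j.
have depth1 : depth a = 1%N.
  apply/eqP; rewrite eqn_leq depth_gt0 andbT -leq_double.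
  have := width_gt0 (leqnn (depth a).*2); rewrite -eq_width // /width /=.
  by case: ifP.
split=> [|j]; first by rewrite depth1.
have [ja|ja] := leqP j (depth a).*2; first exact: eq_width.
rewrite /width [in RHS]leqNgt ja /=.
by rewrite depth1 in ja; rewrite leqNgt ja.
Qed.

(** Lets the depth be replaced by a successor, at which [layer] unfolds; the choice of [e] is
    harmless because equality proofs on nat are irrelevant. *)
Lemma network_layer (R : realType) n (Phi : mlp R n) l
    (e : outw (arch_of Phi) l = 1%N) x :
  l = depth (arch_of Phi) ->
  network Phi x = castmx (e, erefl) (layer Phi x l) 0 0.
Proof.
move=> el; move: e; rewrite /network; move: (outw_depth _).
by rewrite -/(outw _ _) -el => e e'; rewrite (eq_irrelevance e e').
Qed.

(** * Constancy in the degenerate case *)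

Section Constant.
Variables (R : realType) (n : nat) (Phi : mlp R n) (x y : 'cV[R]_n).
Let a := arch_of Phi.
Let p := par Phi.

Lemma layer_eq_leq l l' : (l <= l')%N ->
  layer Phi x l = layer Phi y l -> layer Phi x l' = layer Phi y l'.
Proof.
elim: l' => [|l' IH]; first by case: l.
rewrite leq_eqVlt => /predU1P[-> //|] /IH {}IH /IH /= ->.
by [].
Qed.

Lemma network_constant :
  \rank (W p 1) = 0%N \/ \rank (Wt p (depth a)) = 0%N \/
   (exists l, (1 <= l < depth a)%N /\ \rank (W p l.+1 *m Wt p l) = 0%N) ->
  network Phi x = network Phi y.
Proof.
move=> degenerate.
suff eqL : layer Phi x (depth a) = layer Phi y (depth a).
  by rewrite /network eqL.
have L_gt0 := depth_gt0 a.
case: degenerate => [/eqP|[/eqP|[l [/andP[l_gt0 lL] /eqP]]]];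
  rewrite mxrank_eq0 => /eqP W0.
- by apply: (layer_eq_leq (l := 1)) => //=; rewrite -/p W0 !mul0mx.
- move: W0; rewrite -(prednK L_gt0) /= -/p => ->.
  by rewrite !mul0mx.
- apply: (layer_eq_leq (l := l.+1)) => //.
  (* After distribution, the activations of layer [l] enter the next pre-activation only through the
     vanishing product, so only biases remain. *)
  case: l l_gt0 lL W0 => // l _ lL W0 /=; rewrite -/p.
  by rewrite !mulmxDr !mulmxA W0 !mul0mx.
Qed.

End Constant.

(** * Linear images of open sets *)

Lemma cvg_mx (T : Type) (F : set_system T) (U : topologicalType) m n
    (f : T -> 'M[U]_(m, n)) (M : 'M[U]_(m, n)) : Filter F ->
  (forall i j, f x i j @[x --> F] --> M i j) -> f x @[x --> F] --> M.
Proof.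
move=> FF fM B [P PM sPB].
suff : \forall x \near F, forall i j, P i j (f x i j).
  by apply: filterS => x Px; exact: sPB.
by apply: filter_forall => i; apply: filter_forall => j; exact: fM (PM i j).
Qed.

Lemma mulmx_continuous (R : realType) m n p (A : 'M[R]_(m, n)) :
  continuous (fun x : 'M[R]_(n, p) => A *m x).
Proof.
move=> x; apply: (@cvg_mx _ (nbhs x)) => i j; rewrite mxE.
under eq_cvg do rewrite mxE.
apply: cvg_big => [|k _]; first exact: add_continuous.
by apply: cvgM; [exact: cvg_cst|exact: coord_continuous].
Qed.

(** A right inverse [B] of [A] gives the continuous section y -> x + B (y - A x), which sends A x to
    x; near A x its values stay in [X]. *)
Lemma open_mulmx_image (R : realType) m n p (A : 'M[R]_(m, n))
    (X : set 'M[R]_(n, p)) :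
  row_free A -> open X -> open [set A *m x | x in X].
Proof.
move=> /row_freeP[B AB]; rewrite !openE => oX _ [x Xx <-].
have : B *m y + (x - B *m (A *m x)) @[y --> A *m x] --> x.
  rewrite -[X in _ --> X](addrNK (B *m (A *m x))) [X in _ --> X]addrC.
  by apply: cvgD; [exact: nbhs_filter|exact: mulmx_continuous|exact: (@cvg_cst _ _ _ _ (nbhs_filter _))].
move/(_ _ (oX _ Xx)); apply: (@filterS _ _ (nbhs_filter (A *m x))) => y Xy.
exists (B *m y + (x - B *m (A *m x))) => //.
by rewrite mulmxDr mulmxBr !mulmxA AB !mul1mx subrr addr0.
Qed.

(** * Rank factorizations and the reduced network *)

Lemma full_rank_col_base (R : realType) m n (M : 'M[R]_(m, n)) :
  full_rank (col_base M).
Proof.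
rewrite /full_rank (eqP (col_base_full M)) eq_sym.
exact/eqP/minn_idPr/rank_leq_row.
Qed.

Lemma full_rank_row_base (R : realType) m n (M : 'M[R]_(m, n)) :
  full_rank (row_base M).
Proof.
rewrite /full_rank (eqP (row_base_free M)) eq_sym.
exact/eqP/minn_idPl/rank_leq_col.
Qed.

Lemma not_full_rank_lt (R : realType) m n (M : 'M[R]_(m, n)) :
  ~~ full_rank M -> (\rank M < minn m n)%N.
Proof.
by rewrite /full_rank ltn_neqAle leq_min rank_leq_row rank_leq_col => ->.
Qed.

(* The matrices and biases on both sides of the layer of width n_l, where
   q = m_l and r = m_{l+1}. Keeping the width n_l itself as a field allows it
   to be chosen by a boolean test without any cast of matrix dimensions. *)
Record link (R : realType) (q r : nat) := Link {
  mid : nat;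
  inm : 'M[R]_(r, mid);
  inb : 'cV[R]_r;
  outm : 'M[R]_(mid, q);
  outb : 'cV[R]_mid
}.

Section Reduction.
Variables (R : realType) (n : nat) (Phi : mlp R n).
Let a := arch_of Phi.
Let p := par Phi.

Definition prod_rank l := \rank (W p l.+1 *m Wt p l).

(** At [l = depth a] the output matrix and bias must survive unchanged; the next layer's [W] and [b]
    stored there are junk. *)
Definition reduced_link l : link R (hidw a l) (hidw a l.+1) :=
  if (l < depth a)%N then
    Link (col_base (W p l.+1 *m Wt p l)) (b p l.+1 + W p l.+1 *m bt p l)
      (row_base (W p l.+1 *m Wt p l)) 0
  else Link (W p l.+1) (b p l.+1) (Wt p l) (bt p l).

Lemma reduced_linkE l v :
  let k := reduced_link l in
  inm k *m (outm k *m v + outb k) + inb k =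
  W p l.+1 *m (Wt p l *m v + bt p l) + b p l.+1.
Proof.
rewrite /reduced_link /=; case: ifP => _ //=.
by rewrite addr0 mulmxA mulmx_base mulmxDr mulmxA addrAC addrA.
Qed.

Lemma mid_reduced_link l :
  mid (reduced_link l) = if (l < depth a)%N then prod_rank l else outw a l.
Proof. by rewrite /reduced_link; case: ifP. Qed.

(** The factorization of the first matrix stays abstract because it is used twice: trivially, with
    [A] the identity, and through column and row bases. *)
Variables (nbar : nat) (A : 'M[R]_(nbar, n)) (V : 'M[R]_(hidw a 1, nbar)).
Hypothesis VA : V *m A = W p 1.
Hypothesis nbar_gt0 : (0 < nbar)%N.
Hypothesis prod_rank_gt0 :
  forall l, (1 <= l < depth a)%N -> (0 < prod_rank l)%N.

Definition reduced_outw l := mid (reduced_link l).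

Lemma reduced_outw_gt0 l :
  (l <= depth a)%N -> (0 < with_input nbar reduced_outw l)%N.
Proof.
case: l => //= l lL; rewrite /reduced_outw mid_reduced_link.
by case: ifP => [lL'|_]; [exact: prod_rank_gt0|exact: outw_gt0].
Qed.

Lemma reduced_outw_depth : with_input nbar reduced_outw (depth a) = 1%N.
Proof.
have : reduced_outw (depth a) = outw a (depth a).
  by rewrite /reduced_outw mid_reduced_link ltnn.
move: (outw_depth a) (depth_gt0 a); rewrite /outw.
by case: (depth a) => //= L -> _ ->.
Qed.

Definition reduced_arch : arch nbar :=
  Arch (depth_gt0 a) reduced_outw_gt0 (@hidw_gt0 _ a) reduced_outw_depth.

Definition reduced_params : params R reduced_arch :=
  @Params R nbar reduced_arch
    (fun l => match l return 'M[R]_(hidw a l, outw reduced_arch l.-1) with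
      | 0 => 0 | 1 => V | l'.+2 => inm (reduced_link l'.+1) end)
    (fun l => match l return 'cV[R]_(hidw a l) with
      | 0 => 0 | 1 => b p 1 | l'.+2 => inb (reduced_link l'.+1) end)
    (fun l => match l return 'M[R]_(outw reduced_arch l, hidw a l) with
      | 0 => 0 | l'.+1 => outm (reduced_link l'.+1) end)
    (fun l => match l return 'cV[R]_(outw reduced_arch l) with
      | 0 => 0 | l'.+1 => outb (reduced_link l'.+1) end).

Definition reduced_mlp : mlp R nbar :=
  @MLP R nbar reduced_arch (act Phi) reduced_params.

(** The layers themselves live in spaces of different widths; the pre-activations are what both
    networks share, since hidden widths and activations are kept. *)
Lemma reduced_preact x l :
  W reduced_params l.+1 *m layer reduced_mlp (A *m x) l
    + b reduced_params l.+1 =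
  W p l.+1 *m layer Phi x l + b p l.+1.
Proof.
elim: l => [|l IH] /=; first by rewrite mulmxA VA.
rewrite -[RHS]reduced_linkE /=; congr (_ *m (_ *m _ + _) + _).
by apply/colP => i; rewrite mxE [RHS]mxE -IH.
Qed.

Lemma network_reduced x : network Phi x = network reduced_mlp (A *m x).
Proof.
have eL : (depth a).-1.+1 = depth a by rewrite prednK // depth_gt0.
move: (depth a).-1 eL => L eL.
have e : outw a L.+1 = 1%N by rewrite eL; exact: outw_depth.
have e' : outw reduced_arch L.+1 = 1%N by rewrite eL; exact: reduced_outw_depth.
rewrite (network_layer e) // (network_layer (Phi := reduced_mlp) e') //.
have -> : layer reduced_mlp (A *m x) L.+1 =
    outm (reduced_link L.+1) *m apply_act (W p L.+1 *m layer Phi x L + b p L.+1)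
    + outb (reduced_link L.+1).
  congr (_ *m _ + _).
  by apply/colP => i; rewrite mxE [RHS]mxE reduced_preact.
(* The last link is unfactored, so the outputs differ only in the proof that their width is 1. *)
move: e'; rewrite /= /reduced_outw /reduced_link -eL ltnn /= => e'.
by rewrite (eq_irrelevance e e').
Qed.

Hypothesis V_full : full_rank V.
Hypothesis Wt_last : (0 < \rank (Wt p (depth a)))%N.

Lemma reduced_all_full_rank : all_full_rank reduced_params.
Proof.
move=> [//|l] /andP[_ lL]; split.
  case: l lL => [//|l] lL /=; rewrite /reduced_outw /reduced_link (lL : (l.+1 < depth a)%N) /=.
  exact: full_rank_col_base.
rewrite /= /reduced_outw /reduced_link; case: ifPn => [_|] /=.
  exact: full_rank_row_base.
(* The output matrix is not factored, but it has a single row, so positive rank is full rank. *)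
rewrite -leqNgt => Ll; have eL : l.+1 = depth a.
  by apply/eqP; rewrite eqn_leq lL Ll.
rewrite /full_rank eqn_leq leq_min rank_leq_row rank_leq_col /=.
have outw1 : (outw a l.+1 <= 1)%N by rewrite eL /outw outw_depth.
have rank_gt0 : (0 < \rank (Wt p l.+1))%N by rewrite eL.
exact: leq_trans (geq_minl _ _) (leq_trans outw1 rank_gt0).
Qed.

Hypothesis nbar_le : (nbar <= n)%N.

Lemma smaller_reduced_arch :
  (nbar < n)%N \/
  (exists l, (1 <= l < depth a)%N /\ (prod_rank l < outw a l)%N) ->
  smaller_arch reduced_arch a.
Proof.
have outw_le l : (outw reduced_arch l <= outw a l)%N.
  case: l => [|l]; first exact: nbar_le.
  rewrite /= /reduced_outw mid_reduced_link; case: ifP => // _.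
  by apply: leq_trans (mxrankM_maxr _ _) _; exact: rank_leq_row.
have width_le j : (width reduced_arch j <= width a j)%N.
  by rewrite /width /=; case: ifP => // _; case: ifP.
have width_lt l : (l <= depth a)%N -> (outw reduced_arch l < outw a l)%N ->
    (width reduced_arch l.*2 < width a l.*2)%N.
  by move=> lL; rewrite /width /= leq_double lL odd_double doubleK.
move=> lt; split=> //; apply: ltn_sum_nat => //.
case: lt => [lt|[l [/andP[l_gt0 lL] lt]]].
  by exists 0%N => //; apply: (width_lt 0%N).
exists l.*2; first by rewrite ltnS leq_double ltnW.
apply: width_lt; first exact: ltnW.
by case: l l_gt0 lL lt => // l _ lL; rewrite /= /reduced_outw mid_reduced_link lL.
Qed.

End Reduction.

Theorem theorem3p10 (R : realType) (n : nat) (n_gt0 : (0 < n)%N)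
    (a : arch n) (sigma : activations R a) :
  exists c : params R a -> R,
  forall (k : nat) (X : set 'cV[R]_n) (p : params R a),
  let L := depth a in
  let Phi := MLP sigma p in
  Xi k X Phi ->
  (exists l, (1 <= l <= L)%N /\
     (~~ full_rank (W p l) \/ ~~ full_rank (Wt p l))) ->
  ((0 < \rank (W p 1))%N -> (0 < \rank (Wt p L))%N ->
   (forall l, (1 <= l < L)%N -> (0 < \rank (W p l.+1 *m Wt p l))%N) ->
   exists (nbar : nat) (A : 'M[R]_(nbar, n)) (Y : set 'cV[R]_nbar)
          (Phibar : mlp R nbar),
     (nbar <= n)%N /\
     full_rank A /\
     Xi k Y Phibar /\
     all_full_rank (par Phibar) /\
     smaller_arch (arch_of Phibar) a /\
     (forall x, X x -> network Phi x = network Phibar (A *m x)) /\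
     (forall e : nbar = n,
        castmx (e, erefl n) A = 1%:M /\
        [set castmx (e, erefl 1%N) y | y in Y] = X) /\
     ((nbar < n)%N -> Y = [set A *m x | x in X]))
  /\
  (\rank (W p 1) = 0%N \/ \rank (Wt p L) = 0%N \/
   (exists l, (1 <= l < L)%N /\ \rank (W p l.+1 *m Wt p l) = 0%N) ->
   (forall x, X x -> network Phi x = c p) /\
   (exists tau : R -> R, Ck k tau /\ strictly_monotone tau) /\
   (forall tau : R -> R, Ck k tau -> strictly_monotone tau ->
      let Phibar := const_mlp n_gt0 tau (c p) in
      Xi k X Phibar /\
      equivalent X Phi Phibar /\
      (~ same_arch (const_arch n_gt0) a ->
       smaller_arch (const_arch n_gt0) a))).
Proof.
(* The point 0 may lie outside [X]: [network] is defined on the whole space. *)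
exists (fun p => network (MLP sigma p) 0) => k X p L Phi PhiXi not_full.
split; last first.
  move=> degenerate.
  have const x : X x -> network Phi x = network Phi 0.
    by move=> _; apply: (@network_constant _ _ Phi).
  split=> //; split.
    have L1 : (1 <= 1 <= depth a)%N by exact: depth_gt0.
    exists (sigma 1%N (Ordinal (hidw_gt0 L1))).
    exact: (PhiXi.2 1%N L1).
  move=> tau tauCk tau_mono Phibar; split; first by split=> //; exact: PhiXi.1.
  split; last exact: smaller_const_arch.
  move=> x Xx; rewrite const // /network.
  by rewrite castmx_id /= mul0mx add0r mxE.
move=> W1_gt0 WtL_gt0 prod_gt0.
(* If the first matrix has full rank, the coordinates are kept and the deficient matrix lies
   elsewhere, making some product rank smaller than n_l. *)
have [W1_full|W1_not_full] := boolP (full_rank (W p 1)).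
  have W1A : W p 1 *m 1%:M = W p 1 by rewrite mulmx1.
  exists n, 1%:M, X, (reduced_mlp (Phi := Phi) (W p 1) n_gt0 prod_gt0).
  split=> //; split; first by rewrite /full_rank mxrank1 minnn.
  split=> //; split; first exact: reduced_all_full_rank.
  split.
    apply: smaller_reduced_arch => //; right.
    have [l [/andP[l_gt0 lL] [Wl|Wtl]]] := not_full.
      case: l l_gt0 lL Wl => [//|[|l]] _ lL Wl; first by rewrite W1_full in Wl.
      exists l.+1; split=> //.
      apply: leq_ltn_trans (mxrankM_maxl _ _) _.
      by apply: leq_trans (not_full_rank_lt Wl) _; exact: geq_minr.
    move: lL; rewrite leq_eqVlt => /predU1P[lL|lL]; last first.
      exists l; split; first by rewrite l_gt0.
      apply: leq_ltn_trans (mxrankM_maxr _ _) _.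
      by apply: leq_trans (not_full_rank_lt Wtl) _; exact: geq_minl.
    (* The last output matrix cannot be the deficient one: with a single row, deficiency would mean
       rank 0. *)
    have outw1 : outw a l = 1%N by rewrite lL; exact: outw_depth.
    have := leq_trans (not_full_rank_lt Wtl) (geq_minl _ _).
    by rewrite [X in (_ < X)%N]outw1 lL ltnNge WtL_gt0.
  split=> [x _|]; first exact: network_reduced.
  split=> [e|]; last by rewrite ltnn.
  rewrite (eq_irrelevance e erefl) castmx_id; split=> //.
  by under eq_fun do rewrite castmx_id; rewrite image_id.
(* Here the input width itself drops, so the clause for [nbar = n] is vacuous. *)
have rank_lt : (\rank (W p 1) < n)%N.
  exact: leq_trans (not_full_rank_lt W1_not_full) (geq_minr _ _).
exists (\rank (W p 1)), (row_base (W p 1)), [set row_base (W p 1) *m x | x in X],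
  (reduced_mlp (Phi := Phi) (col_base (W p 1)) W1_gt0 prod_gt0).
split; first exact: ltnW.
split; first exact: full_rank_row_base.
split.
  split; last exact: PhiXi.2.
  by apply: open_mulmx_image; [exact: row_base_free|exact: PhiXi.1].
split; first by apply: reduced_all_full_rank => //; exact: full_rank_col_base.
split; first by apply: smaller_reduced_arch; [exact: ltnW|left].
split=> [x _|]; first by apply: network_reduced; exact: mulmx_base.
by split=> // e; rewrite e ltnn in rank_lt.
Qed.
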